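(* Let $\Gamma<\mathrm{SL}_2(\mathbb{R})$ be a subgroup containing $-I$ and commensurable with $\mathrm{SL}_2(\mathbb{Z})$, let $w\in\mathbb{R}$ with $w\ge1$, and let $\psi$ be a multiplier system for $\Gamma$ of weight $w$. Let $h>0$ be the width of $\Gamma$ at infinity, and let $0\le\alpha<1$ be such that $\psi(T^h)=e^{2\pi i\alpha}$. Let $\mu,\nu\in\frac1h(\mathbb{Z}-\alpha)$, with $\mu\neq0$ and $\nu\ne0$ in case $w>1$, and assume that the limits defining the Rademacher series $c_{\Gamma,\psi,w}(\mu,\nu)$ and $c_{\Gamma,\overline{\psi},2-w}(-\mu,-\nu)$ exist. Then $$-\,\overline{c_{\Gamma,\overline{\psi},2-w}(-\mu,-\nu)\,\mu^{1-w}}=c_{\Gamma,\psi,w}(\mu,\nu)\,\nu^{1-w}.$$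
   Context: Write $\mathrm{e}(x)=e^{2\pi i x}$. All real powers are defined with the principal branch: $x^s=|x|^se^{i\theta s}$ for $x=|x|e^{i\theta}$, $-\pi<\theta\le\pi$; set $0^0=1$, and $0^s=0$ for $s>0$. The overline on numbers denotes complex conjugation. Group data. Matrices act on the upper half-plane $\mathbb{H}$ by Möbius transformations. For $\gamma\in\mathrm{SL}_2(\mathbb{R})$ with lower row $(c,d)$ put $\mathrm{j}(\gamma,\tau)=(c\tau+d)^{-2}$, and $\mathrm{j}(\gamma,\tau)^{w/2}$ means $(c\tau+d)^{-w}$ (so $\mathrm{j}(-I,\tau)^{w/2}=\mathrm{e}(-w/2)$). Let $T^h=\begin{pmatrix}1&h\\0&1\end{pmatrix}$. $\Gamma_\infty$ is the subgroup of upper-triangular matrices in $\Gamma$. The width $h$ of $\Gamma$ at infinity is the unique $h>0$ with $\Gamma_\infty=\langle T^h,-I\rangle$. Multiplier systems. A multiplier system for $\Gamma$ of weight $w$ is a function $\psi:\Gamma\to\mathbb{C}$, here with $|\psi(\gamma)|=1$ for all $\gamma\in\Gamma$, such that $$\psi(\gamma_1)\psi(\gamma_2)\,\mathrm{j}(\gamma_1,\gamma_2\tau)^{w/2}\,\mathrm{j}(\gamma_2,\tau)^{w/2}=\psi(\gamma_1\gamma_2)\,\mathrm{j}(\gamma_1\gamma_2,\tau)^{w/2}$$ for all $\gamma_1,\gamma_2\in\Gamma$, $\tau\in\mathbb{H}$, and satisfying the consistency condition $\psi(-I)=\mathrm{e}(w/2)$. The inverse multiplier system is $\overline{\psi}:\gamma\mapsto\overline{\psi(\gamma)}$,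 a multiplier system of weight $-w$ and hence also of weight $2-w$. Standing assumption: if $\Gamma$ does not act transitively on $\mathbb{Q}\cup\{i\infty\}$ then $\Gamma$ is contained in a group $\tilde\Gamma<\mathrm{SL}_2(\mathbb{R})$ commensurable with $\mathrm{SL}_2(\mathbb{Z})$ that does, and $\psi=\rho\tilde\psi$ with $\rho:\Gamma\to\mathbb{C}^\times$ a group homomorphism and $\tilde\psi$ a multiplier system for $\tilde\Gamma$. Rademacher series. For $K>0$ let $\Gamma_K^\times=\{\begin{pmatrix}a&b\\c&d\end{pmatrix}\in\Gamma: 0<|c|<K\}$. For a multiplier system $\psi$ of weight $w$ with $\psi(T^h)=\mathrm{e}(\alpha)$, and $\mu,\nu\in\frac1h(\mathbb{Z}-\alpha)$, the Rademacher series is $$c_{\Gamma,\psi,w}(\mu,\nu)=\frac1h\lim_{K\to\infty}\sum_{\gamma\in\Gamma_\infty\backslash\Gamma_K^\times/\Gamma_\infty}K_{\gamma,\psi}(\mu,\nu)\,B_{\gamma,w}(\mu,\nu),$$ the sum being over a complete irredundant set of double coset representatives $\gamma=\begin{pmatrix}a&b\\c&d\end{pmatrix}$ chosen with $c>0$, where $$K_{\gamma,\psi}(\mu,\nu)=\mathrm{e}\!\left(\mu\tfrac ac\right)\mathrm{e}\!\left(\nu\tfrac dc\right)\psi(\gamma),$$ $$B_{\gamma,w}(\mu,\nu)=\begin{cases}\mathrm{e}\!\left(-\frac w4\right)\displaystyle\sum_{k\ge0}\left(\frac{2\pi}{c}\right)^{2k+w}\frac{(-\mu)^k}{k!}\frac{\nu^{k+w-1}}{\Gamma(k+w)},&w\ge1,\\[2ex]\mathrm{e}\!\left(-\frac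 w4\right)\displaystyle\sum_{k\ge0}\left(\frac{2\pi}{c}\right)^{2k+2-w}\frac{(-\mu)^{k+1-w}}{\Gamma(k+2-w)}\frac{\nu^k}{k!},&w\le1\end{cases}$$ (here $\Gamma(\cdot)$ with a numerical argument is the Gamma function). The series $c_{\Gamma,\overline\psi,2-w}$ is defined in the same way with $(\psi,w)$ replaced by $(\overline\psi,2-w)$; since $\overline\psi(T^h)=\mathrm{e}(-\alpha)$, its arguments lie in $\frac1h(\mathbb{Z}+\alpha)$. *)

(* Defs.v *)
From HB Require Import structures.
From mathcomp Require Export all_boot all_order all_algebra.
From mathcomp Require Export complex.
From mathcomp Require Export all_classical all_reals all_analysis.
Export Order.TTheory GRing.Theory Num.Theory.
Export numFieldNormedType.Exports.
Import Normc.

Set Implicit Arguments.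
Unset Strict Implicit.
Unset Printing Implicit Defensive.

Local Open Scope classical_set_scope.
Local Open Scope ring_scope.
Local Open Scope complex_scope.

Section ComplexPowers.
Context {R : realType}.
Implicit Types (x s t : R) (z : R[i]).

Definition cis t : R[i] := cos t +i* sin t.

(* e(x) = exp(2 pi i x) for real x *)
Definition ee x : R[i] := cis (2 * pi * x).

(* The principal argument, with values in ]-pi, pi]; see [cargP]. *)
Definition carg z : R :=
  if 0 <= complex.Im z then acos (complex.Re z / normc z)
  else - acos (complex.Re z / normc z).

Lemma cargP z : z != 0 ->
  - pi < carg z <= pi /\ z = (normc z)%:C * cis (carg z).
Proof.
move=> z0.
have n0 : 0 < normc z.
  rewrite lt_def (_ : 0 <= normc z) ?andbT; last by case: (z) => a b; exact: sqrtr_ge0.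
  by apply: contraNN z0 => /eqP/eq0_normc ->.
have hn : normc z ^+ 2 = complex.Re z ^+ 2 + complex.Im z ^+ 2.
  by rewrite /normc; case: z {z0 n0} => a b; rewrite sqr_sqrtr// addr_ge0 ?sqr_ge0.
set u := complex.Re z / normc z.
have hu2 : 1 - u ^+ 2 = (complex.Im z / normc z) ^+ 2.
  rewrite /u !expr_div_n; apply/eqP; rewrite subr_eq -mulrDl addrC -hn divff//.
  by rewrite expf_neq0// gt_eqF.
have hu : -1 <= u <= 1.
  rewrite -ler_norml -(@ler_pXn2r _ 2)// ?nnegrE// expr1n real_normK ?num_real//.
  by rewrite -subr_ge0 hu2 sqr_ge0.
have hs : sin (acos u) = `|complex.Im z| / normc z.
  by rewrite sin_acos// hu2 sqrtr_sqr normrM normfV (gtr0_norm n0).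
have a0 := acos_ge0 hu; have api := acos_lepi hu.
have p0 : 0 < pi :> R := pi_gt0 R.
have key : complex.Re z = normc z * u by rewrite /u mulrC divfK// gt_eqF.
have E t : (normc z)%:C * cis t = (normc z * cos t) +i* (normc z * sin t).
  by rewrite /cis; simpc.
rewrite E /carg -/u; case: (leP 0 (complex.Im z)) => hi.
  split; first by rewrite api andbT (lt_le_trans _ a0)// oppr_lt0.
  rewrite acosK// hs (ger0_norm hi) -key mulrC divfK ?gt_eqF//.
  by case: (z).
split.
  apply/andP; split; last by rewrite (le_trans _ (ltW p0))// oppr_le0.
  rewrite ltrN2 lt_neqAle api andbT; apply/eqP => ap.
  have := hs; rewrite ap sinpi => /esym/eqP.
  by rewrite mulf_eq0 invr_eq0 normr_eq0 (gt_eqF n0) (lt_eqF hi).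
rewrite cosN sinN acosK// hs (ltr0_norm hi) -key mulNr opprK mulrC divfK ?gt_eqF//.
by case: (z).
Qed.

(* Principal branch of z ^ s; as 0 `^ 0 = 1 and 0 `^ s = 0 for s != 0, the
   value at z = 0 is 1 if s = 0, and 0 otherwise. *)
Definition cpow z s : R[i] := (normc z `^ s)%:C * cis (s * carg z).

(* Euler's integral; only used at arguments >= 1. *)
Definition Gamma x : R :=
  Rintegral (@lebesgue_measure R) `]0, +oo[ (fun t => t `^ (x - 1) * expR (- t)).

End ComplexPowers.

Section Groups.
Context {R : realType}.
Implicit Types (g : 'M[R]_2) (G H : set 'M[R]_2).

Definition SL2R : set 'M[R]_2 := [set g | \det g = 1].

Definition SL2Z : set 'M[R]_2 :=
  [set g | \det g = 1 /\ forall i j, g i j \is a Num.int].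

Definition is_subgroup G : Prop :=
  [/\ G `<=` SL2R, G 1, (forall g1 g2, G g1 -> G g2 -> G (g1 * g2))
    & forall g, G g -> G g^-1].

Definition finite_index H G : Prop :=
  finite_set [set [set g * k | k in H] | g in G].

Definition commensurable G H : Prop :=
  finite_index (G `&` H) G /\ finite_index (G `&` H) H.

(* T^h *)
Definition Tmx (h : R) : 'M[R]_2 :=
  \matrix_(i, j) (if i == j then 1 else if i == 0 then h else 0).

Definition upper_triangular G : set 'M[R]_2 := [set g | G g /\ g 1 0 = 0].

Definition is_width G (h : R) : Prop :=
  0 < h /\ upper_triangular G = smallest is_subgroup [set Tmx h; -1].

(* P^1(R), with None the point at infinity *)
Definition cusp_act g (x : option R) : option R :=
  match x with
  | None => if g 1 0 == 0 then None else Some (g 0 0 / g 1 0)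
  | Some r => if g 1 0 * r + g 1 1 == 0 then None
              else Some ((g 0 0 * r + g 0 1) / (g 1 0 * r + g 1 1))
  end.

Definition cusps : set (option R) :=
  [set x | if x is Some r then exists q : rat, r = ratr q else True].

Definition transitive_on_cusps G : Prop :=
  forall x y, cusps x -> cusps y -> exists2 g, G g & cusp_act g x = y.

End Groups.

Section Multipliers.
Context {R : realType}.
Implicit Types (g : 'M[R]_2) (G H : set 'M[R]_2) (w : R) (tau : R[i]).

Definition denom g tau : R[i] := (g 1 0)%:C * tau + (g 1 1)%:C.

Definition mobius g tau : R[i] :=
  ((g 0 0)%:C * tau + (g 0 1)%:C) / denom g tau.

(* j(g, tau)^(w/2), which stands for (c tau + d)^(-w) *)
Definition jpow g tau w : R[i] := cpow (denom g tau) (- w).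

Definition is_multiplier G w (psi : 'M[R]_2 -> R[i]) : Prop :=
  [/\ forall g, G g -> `|psi g| = 1,
      forall g1 g2 tau, G g1 -> G g2 -> 0 < complex.Im tau ->
        psi g1 * psi g2 * jpow g1 (mobius g2 tau) w * jpow g2 tau w
        = psi (g1 * g2) * jpow (g1 * g2) tau w
    & psi (-1) = ee (w / 2)].

(* The weight of the multiplier system psi' on the larger group is left free. *)
Definition standing_assumption G (psi : 'M[R]_2 -> R[i]) : Prop :=
  ~ transitive_on_cusps G ->
  exists H (w' : R) (rho psi' : 'M[R]_2 -> R[i]),
  [/\ [/\ is_subgroup H, commensurable H SL2Z, transitive_on_cusps H & G `<=` H],
      forall g, G g -> rho g != 0,
      forall g1 g2, G g1 -> G g2 -> rho (g1 * g2) = rho g1 * rho g2,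
      is_multiplier H w' psi'
    & forall g, G g -> psi g = rho g * psi' g].

Definition conj_mult (psi : 'M[R]_2 -> R[i]) : 'M[R]_2 -> R[i] :=
  fun g => (psi g)^*.

End Multipliers.

Section RademacherSeries.
Context {R : realType}.
Implicit Types (g : 'M[R]_2) (G S : set 'M[R]_2) (psi : 'M[R]_2 -> R[i]).
Implicit Types (h alpha w mu nu K : R).

Definition shifted_lattice h alpha : set R :=
  [set ((m%:~R - alpha) / h) | m in [set: int]].

Definition truncation G K : set 'M[R]_2 := [set g | G g /\ 0 < `|g 1 0| < K].

Definition double_coset G g : set 'M[R]_2 :=
  [set p * g * q | p in upper_triangular G & q in upper_triangular G].

(* S is a complete irredundant set of representatives, all with c > 0, of the
   double cosets in truncation G K *)
Definition double_coset_reps G K S : Prop :=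
  (forall s, S s -> truncation G K s /\ 0 < s 1 0) /\
  (forall g, truncation G K g -> exists! s, S s /\ double_coset G s g).

Definition kloosterman_term psi mu nu g : R[i] :=
  ee (mu * (g 0 0 / g 1 0)) * ee (nu * (g 1 1 / g 1 0)) * psi g.

(* The two cases agree at w = 1. Limits in C are taken in the normed space
   R[i]^o. *)
Definition bessel_term w mu nu g : R[i] :=
  let c := g 1 0 in
  if 1 <= w then
    ee (- (w / 4)) *
    limn (series (fun k : nat =>
      ((2 * pi / c) `^ (2 * k%:R + w))%:C
      * ((- mu)%:C ^+ k / k`!%:R)
      * (cpow nu%:C (k%:R + w - 1) / (Gamma (k%:R + w))%:C) : R[i]^o))
  else
    ee (- (w / 4)) *
    limn (series (fun k : nat =>
      ((2 * pi / c) `^ (2 * k%:R + 2 - w))%:C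
      * (cpow (- mu)%:C (k%:R + 1 - w) / (Gamma (k%:R + 2 - w))%:C)
      * (nu%:C ^+ k / k`!%:R) : R[i]^o)).

(* [reps K] is meant to satisfy [double_coset_reps G K]. It is then a finite set
   if G is commensurable with SL2Z. *)
Definition rademacher_sum (reps : R -> set 'M[R]_2) psi w mu nu K : R[i]^o :=
  \sum_(g \in reps K) (kloosterman_term psi mu nu g * bessel_term w mu nu g).

Definition rademacher (reps : R -> set 'M[R]_2) h psi w mu nu : R[i] :=
  (h^-1)%:C * lim (rademacher_sum reps psi w mu nu K @[K --> +oo]).

End RademacherSeries.

(* Main.v *)
Require Import Defs.
From mathcomp Require Import ring lra.
Import Normc.

(** The duality holds term by term. For each matrix [g] the Kloosterman factor of
    the dual series is the complex conjugate of the original one, and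
    [mu ^ (k + w - 1) * mu ^ (1 - w) = mu ^ k] turns the conjugated, rescaled
    power series of weight [2 - w] into that of weight [w]; the sign comes from
    [e((2 - w) / 4) = - e(- w / 4)]. The two sums may use different double coset
    representatives, but the terms are constant on double cosets:
    replacing [g] by [T^x g T^y] multiplies the exponentials by
    [e(mu x) e(nu y)] and [psi g] by the inverse of this number. *)

Set Implicit Arguments.
Unset Strict Implicit.
Unset Printing Implicit Defensive.

Local Open Scope classical_set_scope.
Local Open Scope ring_scope.
Local Open Scope complex_scope.

(** * Principal powers and the exponential [ee] *)

Section ComplexPowers.
Context {R : realType}.
Implicit Types (x y s t : R) (z : R[i]).

Lemma cisD x y : cis (x + y) = cis x * cis y.
Proof.
by rewrite /cis; simpc; rewrite cosD sinD; congr (_ +i* _); rewrite addrC.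
Qed.

Lemma conjcM (z1 z2 : R[i]) : (z1 * z2)^*%C = z1^*%C * z2^*%C.
Proof. exact: rmorphM. Qed.

Lemma cis0 : cis 0 = 1 :> R[i].
Proof. by rewrite /cis cos0 sin0. Qed.

Lemma cispi : cis pi = -1 :> R[i].
Proof. by rewrite /cis cospi sinpi; simpc. Qed.

Lemma conj_cis x : (cis x)^*%C = cis (- x).
Proof. by rewrite /cis cosN sinN; simpc. Qed.

Lemma cis_neq0 x : cis x != 0.
Proof.
apply/eqP => x0; have /eqP : cis (x - x) = 1 :> R[i] by rewrite subrr cis0.
by rewrite cisD x0 mul0r eq_sym oner_eq0.
Qed.

Lemma eeD x y : ee (x + y) = ee x * ee y.
Proof. by rewrite /ee mulrDr cisD. Qed.

Lemma ee0 : ee 0 = 1 :> R[i].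
Proof. by rewrite /ee mulr0 cis0. Qed.

Lemma conj_ee x : (ee x)^*%C = ee (- x).
Proof. by rewrite /ee conj_cis mulrN. Qed.

Lemma ee_half : ee 2^-1 = -1 :> R[i].
Proof. by rewrite /ee mulrAC divff ?pnatr_eq0// mul1r cispi. Qed.

Lemma ee_int (m : int) : ee m%:~R = 1 :> R[i].
Proof.
have e1 : ee 1 = 1 :> R[i].
  by rewrite [1%R in LHS](splitr 1) div1r eeD ee_half mulrNN mulr1.
have e_nat n : ee n%:R = 1 :> R[i].
  by elim: n => [|n IH]; rewrite ?ee0// -natr1 eeD IH e1 mulr1.
case: m => n; first exact: e_nat.
by rewrite NegzE rmorphN /= -conj_ee e_nat conjc1.
Qed.

Lemma normc_ge0 z : 0 <= normc z.
Proof. by case: z => a b; exact: sqrtr_ge0. Qed.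

Lemma normc_neq0 z : z != 0 -> normc z != 0.
Proof. by apply: contraNN => /eqP/eq0_normc ->. Qed.

Lemma cpow_neq0 z s : z != 0 -> cpow z s != 0.
Proof.
move=> z0; rewrite mulf_neq0 ?cis_neq0//.
rewrite (inj_eq (@complexI R) _ 0) gt_eqF// powR_gt0// lt_def normc_ge0.
by rewrite normc_neq0.
Qed.

Lemma cpowr0 z : cpow z 0 = 1.
Proof. by rewrite /cpow powRr0 mul0r cis0 mulr1. Qed.

Lemma cpowr1 z : z != 0 -> cpow z 1 = z.
Proof.
by move=> z0; have [_ zE] := cargP z0; rewrite /cpow powRr1 ?normc_ge0// mul1r -zE.
Qed.

(** Both powers use the same argument [carg z], so real exponents add without any branch
    correction. *)
Lemma cpowD z s t : z != 0 -> cpow z (s + t) = cpow z s * cpow z t.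
Proof.
move=> z0; rewrite /cpow powRD ?normc_neq0 ?implybT// mulrDl cisD rmorphM.
by rewrite mulrACA.
Qed.

Lemma cpow0 s : s != 0 -> cpow 0 s = 0 :> R[i].
Proof. by move=> s0; rewrite /cpow normc0 powR0// mul0r. Qed.

Lemma cpow1 s : cpow 1 s = 1 :> R[i].
Proof.
rewrite /cpow /carg /= lexx expr1n expr0n addr0 sqrtr1 divr1 acos1 mulr0.
by rewrite powR1 cis0 mulr1.
Qed.

(** Links principal powers to ring powers; at [z = 0] the convention 0^0 = 1 settles [k = 0]. *)
Lemma cpow_nat z (k : nat) : cpow z k%:R = z ^+ k.
Proof.
have [->|z0] := eqVneq z 0.
  by case: k => [|k]; rewrite ?cpowr0// expr0n cpow0// pnatr_eq0.
elim: k => [|k IH]; first by rewrite cpowr0.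
by rewrite -natr1 cpowD// IH cpowr1// exprSr.
Qed.

End ComplexPowers.

(* No convergence is assumed: if [f] diverges, so does [phi \o f], and both limits
   are the junk value [point]. *)
Lemma lim_homeo (T : Type) (F : set_system T) (FF : ProperFilter F)
    (K : numFieldType) (V : normedModType K) (phi psi : V -> V) (f : T -> V) :
  continuous phi -> continuous psi -> cancel phi psi -> phi point = point ->
  lim (phi (f x) @[x --> F]) = phi (lim (f x @[x --> F])).
Proof.
move=> cphi cpsi phiK phi0.
have [cf|df] := pselect (cvg (f x @[x --> F])).
  by apply/cvg_lim => //; apply: continuous_cvg => //; exact: cphi.
rewrite (dvgP df) dvgP ?phi0//.
apply: contra_not df => /cvg_ex[l fl]; apply/cvg_ex; exists (psi l).
have := continuous_cvg _ (cpsi l) fl.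
rewrite (_ : psi \o (fun x => phi (f x)) = f); last first.
  by apply/funext => x; exact: phiK.
exact.
Qed.

(* Injectivity makes the supports on both sides coincide, so that the case of an
   infinite support, where both sums are 0, is included. *)
Lemma fsum_additive (I : choiceType) (U V : zmodType) (phi : {additive U -> V})
    (P : set I) (F : I -> U) : injective phi ->
  phi (\sum_(i \in P) F i) = \sum_(i \in P) phi (F i).
Proof.
move=> phiI; rewrite raddf_sum.
suff -> : finite_support 0 P F = finite_support 0 P (fun i => phi (F i)) by [].
rewrite /finite_support !unlock; congr (finmap.enum_fset (fset_set _)).
rewrite predeqE => i /=; split=> -[Pi F0]; split=> //; apply: contra_not F0.
  by rewrite -[X in _ = X](raddf0 phi) => /phiI.
by move=> ->; rewrite raddf0.
Qed.

(** * Limits under conjugation and scaling *)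

Section ComplexLimits.
Context {R : realType}.

(** Conjugation is an isometry, so the same [e] bounds both distances. *)
Lemma conjc_continuous : continuous (fun z : R[i]^o => z^*%C : R[i]^o).
Proof.
move=> z; have FF := nbhs_filter (z : R[i]^o).
apply/(@cvgrPdist_lt _ _ _ _ FF) => e e0.
have /(@cvgrPdist_lt _ _ _ _ FF)/(_ e e0) :
    (y : R[i]^o) @[y --> (z : R[i]^o)] --> (z : R[i]^o).
  exact: cvg_id.
by apply: filterS => y; rewrite -rmorphB normcJ.
Qed.

Context {T : Type} {F : set_system T} {FF : ProperFilter F}.

Lemma lim_mulr (a : R[i]) (f : T -> R[i]^o) : a != 0 ->
  lim ((f x * a : R[i]^o) @[x --> F]) = lim (f x @[x --> F]) * a.
Proof.
move=> a0; apply: (@lim_homeo _ F _ _ (R[i]^o) (fun z => z * a) (fun z => z / a)).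
- by move=> z; exact: mulrr_continuous.
- by move=> z; exact: mulrr_continuous.
- exact: mulfK.
(* The default value [point] of [R[i]^o] is 0, which multiplication by [a] fixes. *)
- exact: mul0r a.
Qed.

Lemma lim_conjc (f : T -> R[i]^o) :
  lim (((f x)^*%C : R[i]^o) @[x --> F]) = (lim (f x @[x --> F]))^*%C.
Proof.
apply: (@lim_homeo _ F _ _ (R[i]^o) (fun z : R[i]^o => z^*%C : R[i]^o) (fun z => z^*%C)).
- exact: conjc_continuous.
- exact: conjc_continuous.
- exact: conjcK.
- exact: conjc0.
Qed.

End ComplexLimits.

(** * Termwise duality of the Bessel factors *)

Section Duality.
Context {R : realType}.
Implicit Types (g : 'M[R]_2) (w mu nu x : R).

Lemma limn_series_mulr (u : nat -> R[i]^o) (a : R[i]) : a != 0 ->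
  limn (series (fun k => u k * a : R[i]^o)) = limn (series u) * a.
Proof.
move=> a0; rewrite -lim_mulr//.
suff -> : series (fun k => u k * a : R[i]^o) =
          (fun n => series u n * a : R[i]^o) by [].
by apply/funext => n; rewrite /series /= mulr_suml.
Qed.

Lemma eq_limn_series (u v : nat -> R[i]^o) : u =1 v ->
  limn (series u) = limn (series v).
Proof. by move=> /funext ->. Qed.

Lemma limn_series_conjc (u : nat -> R[i]^o) :
  limn (series (fun k => (u k)^*%C : R[i]^o)) = (limn (series u))^*%C.
Proof.
rewrite -lim_conjc.
suff -> : series (fun k => (u k)^*%C : R[i]^o) =
          (fun n => (series u n)^*%C : R[i]^o) by [].
by apply/funext => n; rewrite /series /= rmorph_sum.
Qed.

(* At [w = 1] the case [x = 0] is allowed, thanks to the convention 0^0 = 1. *)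
Lemma cpow_shift w x (k : nat) : 1 <= w -> (1 < w -> x != 0) ->
  cpow x%:C (k%:R + w - 1) * cpow x%:C (1 - w) = (x ^+ k)%:C.
Proof.
rewrite le_eqVlt => /predU1P[<- _|w1 /(_ w1) x0].
  by rewrite subrr cpowr0 mulr1 addrK cpow_nat rmorphXn.
rewrite -cpowD ?(inj_eq (@complexI R) _ 0)//.
have -> : k%:R + w - 1 + (1 - w) = k%:R by ring.
by rewrite cpow_nat rmorphXn.
Qed.

Lemma cpow_weight_neq0 w x : 1 <= w -> (1 < w -> x != 0) ->
  cpow x%:C (1 - w) != 0.
Proof.
rewrite le_eqVlt => /predU1P[<- _|w1 /(_ w1) x0].
  by rewrite subrr cpowr0 oner_neq0.
by rewrite cpow_neq0// (inj_eq (@complexI R) _ 0).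
Qed.

Lemma conj_ee_weight w : - (ee (- ((2 - w) / 4)))^*%C = ee (- (w / 4)).
Proof.
rewrite conj_ee opprK (_ : (2 - w) / 4 = 2^-1 + - (w / 4)); last by field.
by rewrite eeD ee_half mulN1r opprK.
Qed.

Definition bessel_coef w mu nu g (k : nat) : R[i] :=
  ((2 * pi / g 1 0) `^ (2 * k%:R + w))%:C * ((- mu)%:C ^+ k / k`!%:R)
  * (cpow nu%:C (k%:R + w - 1) / (Gamma (k%:R + w))%:C).

(** The summand of the second branch of [bessel_term] at weight [2 - w] and arguments [- mu],
    [- nu], with exponents simplified and the phase left out. *)
Definition bessel_coef_dual w mu nu g (k : nat) : R[i] :=
  ((2 * pi / g 1 0) `^ (2 * k%:R + w))%:C
  * (cpow mu%:C (k%:R + w - 1) / (Gamma (k%:R + w))%:C)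
  * ((- nu)%:C ^+ k / k`!%:R).

(** For [w > 1] the weight [2 - w] selects the second branch. At [w = 1] it selects the first one,
    but there all exponents are natural numbers and the two branches have the same summands. *)
Lemma bessel_term_dualE w mu nu g : 1 <= w ->
  bessel_term (2 - w) (- mu) (- nu) g =
  ee (- ((2 - w) / 4)) * limn (series (bessel_coef_dual w mu nu g : nat -> R[i]^o)).
Proof.
move=> w1; rewrite /bessel_term; case: ifPn => w2.
  have w1E : w = 1 by lra.
  apply: (congr1 ( *%R _)); apply: eq_limn_series => k.
  rewrite /bessel_coef_dual w1E.
  have -> : 2 - 1 = 1 :> R by ring.
  rewrite addrK !cpow_nat opprK -[LHS]mulrA -[RHS]mulrA.
  by apply: (congr1 ( *%R _)); rewrite mulrACA [RHS]mulrACA [_^-1 * _]mulrC.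
apply: (congr1 ( *%R _)); apply: eq_limn_series => k.
rewrite /bessel_coef_dual opprK.
have -> : 2 * k%:R + 2 - (2 - w) = 2 * k%:R + w by ring.
have -> : k%:R + 1 - (2 - w) = k%:R + w - 1 by ring.
by have -> : k%:R + 2 - (2 - w) = k%:R + w by ring.
Qed.

(** After rescaling, the dual coefficient is a real number, so conjugation fixes it; both sides
    reduce to the common factor [a] times a monomial in [mu] and [nu]. *)
Lemma bessel_coef_dual_conj w mu nu g k :
  1 <= w -> (1 < w -> mu != 0 /\ nu != 0) ->
  (bessel_coef_dual w mu nu g k * cpow mu%:C (1 - w))^*%C
  = bessel_coef w mu nu g k * cpow nu%:C (1 - w).
Proof.
move=> w1 mn.
have mu0 : 1 < w -> mu != 0 by move=> /mn[].
have nu0 : 1 < w -> nu != 0 by move=> /mn[].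
pose a : R := (2 * pi / g 1 0) `^ (2 * k%:R + w) / (k`!%:R * Gamma (k%:R + w)).
transitivity ((a * ((- nu) ^+ k * mu ^+ k))%:C).
  rewrite -[RHS]conjc_real; congr (_^*%C).
  transitivity (((2 * pi / g 1 0) `^ (2 * k%:R + w))%:C
    * (cpow mu%:C (k%:R + w - 1) * cpow mu%:C (1 - w))
    * ((- nu)%:C ^+ k) * (k`!%:R^-1 / (Gamma (k%:R + w))%:C)).
    by rewrite /bessel_coef_dual; ring.
  rewrite cpow_shift// /a invfM !rmorphM !rmorphXn !fmorphV rmorph_nat; ring.
transitivity (((2 * pi / g 1 0) `^ (2 * k%:R + w))%:C
  * (cpow nu%:C (k%:R + w - 1) * cpow nu%:C (1 - w))
  * ((- mu)%:C ^+ k) * (k`!%:R^-1 / (Gamma (k%:R + w))%:C)); last first.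
  by rewrite /bessel_coef; ring.
rewrite cpow_shift// /a invfM !rmorphM !rmorphXn !fmorphV rmorph_nat.
(* Both monomials carry the sign (-1)^k, attached to [nu] on one side and to [mu] on the other. *)
rewrite !rmorphN [(- _) ^+ _ in LHS]exprNn [(- _) ^+ _ in RHS]exprNn; ring.
Qed.

Lemma bessel_term_dual w mu nu g : 1 <= w -> (1 < w -> mu != 0 /\ nu != 0) ->
  - (bessel_term (2 - w) (- mu) (- nu) g * cpow mu%:C (1 - w))^*%C
  = bessel_term w mu nu g * cpow nu%:C (1 - w).
Proof.
move=> w1 mn.
have mu0 : cpow mu%:C (1 - w) != 0 by rewrite cpow_weight_neq0// => /mn[].
have nu0 : cpow nu%:C (1 - w) != 0 by rewrite cpow_weight_neq0// => /mn[].
(* The nonzero rescaling factors move inside the series, which leaves phases and coefficients to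
   compare separately. *)
rewrite bessel_term_dualE// -mulrA -(limn_series_mulr _ mu0).
rewrite rmorphM -mulNr conj_ee_weight -[X in _ * X = _]limn_series_conjc.
rewrite /bessel_term w1 -[RHS]mulrA -(limn_series_mulr _ nu0).
apply: (congr1 ( *%R _)); apply: eq_limn_series => k.
exact: bessel_coef_dual_conj.
Qed.

End Duality.

(** * Translations, upper triangular subgroup and double coset representatives *)

Section Matrices.
Context {R : realType}.
Implicit Types (g p q : 'M[R]_2) (G : set 'M[R]_2) (x y : R).

Lemma mulmx2E g p i j : (g * p) i j = g i 0 * p 0 j + g i 1 * p 1 j.
Proof.
rewrite mxE !big_ord_recl big_ord0 addr0.
by rewrite (_ : lift ord0 ord0 = 1)//; exact: val_inj.
Qed.

Lemma matrix2P g p :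
  g 0 0 = p 0 0 -> g 0 1 = p 0 1 -> g 1 0 = p 1 0 -> g 1 1 = p 1 1 -> g = p.
Proof.
have ord2 (i : 'I_2) : i = 0 \/ i = 1.
  by case: i => -[|[|//]] ?; [left|right]; exact: val_inj.
by move=> *; apply/matrixP => i j; case: (ord2 i) => ->; case: (ord2 j) => ->.
Qed.

Lemma TmxE x : (Tmx x 0 0 = 1) * (Tmx x 0 1 = x) * (Tmx x 1 0 = 0) * (Tmx x 1 1 = 1).
Proof. by rewrite !mxE. Qed.

Lemma mxN g i j : (- g) i j = - g i j.
Proof. by rewrite mxE. Qed.

Lemma TmxD x y : Tmx (x + y) = Tmx x * Tmx y.
Proof. by apply: matrix2P; rewrite mulmx2E !TmxE; ring. Qed.

Lemma Tmx0 : Tmx 0 = 1 :> 'M[R]_2.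
Proof. by apply: matrix2P; rewrite TmxE mxE. Qed.

Lemma Tmx_inv x : (Tmx x)^-1 = Tmx (- x).
Proof.
have TTN y : Tmx y * Tmx (- y) = 1 by rewrite -TmxD subrr Tmx0.
have TNT : Tmx (- x) * Tmx x = 1 by rewrite -[x in X in _ * X]opprK TTN.
have Tu : Tmx x \is a GRing.unit by apply/unitrP; exists (Tmx (- x)).
by apply: (mulrI Tu); rewrite mulrV// TTN.
Qed.

Lemma SL2R_unit g : SL2R g -> g \is a GRing.unit.
Proof. move=> g1; suff : g \in unitmx by [].
by rewrite unitmxE g1 unitr1. Qed.

Lemma SL2R_det g : SL2R g -> g 0 0 * g 1 1 - g 0 1 * g 1 0 = 1.
Proof.
rewrite /SL2R /= (expand_det_row _ 0) !big_ord_recl big_ord0 addr0.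
rewrite /cofactor !det_mx11 !mxE /=.
rewrite (_ : lift ord0 ord0 = 1); last exact: val_inj.
rewrite (_ : lift 1 0 = 0); last exact: val_inj.
by rewrite expr0 mul1r expr1 mulN1r mulrN.
Qed.

Lemma upper_triangular_subgroup G :
  is_subgroup G -> is_subgroup (upper_triangular G).
Proof.
move=> [GS G1 GM GV]; split.
- by move=> g [/GS].
- by split=> //; rewrite mxE.
- move=> g p [Gg g0] [Gp p0]; split; first exact: GM.
  by rewrite mulmx2E g0 p0 mul0r mulr0 addr0.
- move=> g [Gg g0]; split; first exact: GV.
  (* The lower left entry of g^-1 g = 1 is (g^-1)_10 g_00, and g_00 = 0 would contradict determinant
     one. *)
  move: (mulVr (SL2R_unit (GS _ Gg))) => /(congr1 (fun p => p 1 0)).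
  rewrite mulmx2E g0 mulr0 addr0 mxE/= => /eqP; rewrite mulf_eq0 => /orP[/eqP//|/eqP g00].
  have /eqP := SL2R_det (GS _ Gg).
  by rewrite g0 g00 mul0r mulr0 subrr eq_sym oner_eq0.
Qed.

Lemma double_coset_sym G g p : is_subgroup G ->
  double_coset G g p -> double_coset G p g.
Proof.
move=> subG; have [US _ _ UV] := upper_triangular_subgroup subG.
move=> [t Ut [u Uu] <-]; exists t^-1; first exact: UV.
exists u^-1; first exact: UV.
have tU := SL2R_unit (US _ Ut); have uU := SL2R_unit (US _ Uu).
by rewrite -!mulrA mulKr// mulrV// mulr1.
Qed.

(** Sending each element of [S'] to the element of [S] representing its double coset is a bijection,
    by uniqueness of representatives on either side. *)
Lemma reindex_double_coset_reps G K (S S' : set 'M[R]_2) (V : nmodType)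
    (f : 'M[R]_2 -> V) : is_subgroup G ->
  double_coset_reps G K S -> double_coset_reps G K S' ->
  (forall g p, S g -> S' p -> double_coset G g p -> f g = f p) ->
  \sum_(g \in S) f g = \sum_(g \in S') f g.
Proof.
move=> subG [S1 S2] [S'1 S'2] fE.
have /choice[phi phiP] g : exists p, S' g -> S p /\ double_coset G p g.
  (* Outside [S'] the value of [phi] is arbitrary; [g] itself is taken. *)
  have [S'g|] := pselect (S' g); last by exists g.
  by have [p [Hp _]] := S2 _ (S'1 _ S'g).1; exists p.
have dc_uniq g p q : S g -> S p -> truncation G K q ->
    double_coset G g q -> double_coset G p q -> g = p.
  by move=> Sg Sp /S2[r [_ rU]] gq pq; rewrite -(rU g)// (rU p).
have dc_uniq' g p q : S' g -> S' p -> truncation G K q ->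
    double_coset G g q -> double_coset G p q -> g = p.
  by move=> Sg Sp /S'2[r [_ rU]] gq pq; rewrite -(rU g)// (rU p).
rewrite (reindex_fsbig phi S' S); last first.
  split.
  - by move=> g /phiP[].
  (* Injectivity: [g] and [p] both represent the double coset of [phi g = phi p]. *)
  - move=> g p /set_mem S'g /set_mem S'p phigp.
    have [Sg gg] := phiP _ S'g; have [Sp pp] := phiP _ S'p.
    apply: (dc_uniq' _ _ _ S'g S'p (S1 _ Sg).1); first exact: double_coset_sym.
    by rewrite phigp; exact: double_coset_sym.
  (* Surjectivity: if [p] in [S'] represents [g], then [phi p] and [g] both represent [p]. *)
  - move=> g Sg; have [p [[S'p pg] _]] := S'2 _ (S1 _ Sg).1.
    exists p => //; have [Sp pp] := phiP _ S'p.
    apply: (dc_uniq _ _ _ Sp Sg (S'1 _ S'p).1) => //; exact: double_coset_sym.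
apply: eq_fsbigr => g /set_mem S'g; have [Sg gg] := phiP _ S'g.
exact: fE.
Qed.

End Matrices.

(** * Invariance of the summands on double cosets *)

Section Invariance.
Context {R : realType}.
Context (G : set 'M[R]_2) (w : R) (psi : 'M[R]_2 -> R[i]).
Context (subG : is_subgroup G) (psiM : is_multiplier G w psi).
Implicit Types (g p q : 'M[R]_2) (x y mu nu : R).

(** The point ['i] is the test point at which the multiplier relation is cancelled: c i + d = 0
    would force c = d = 0, against determinant one. *)
Lemma jpow_i_neq0 g : G g -> jpow g 'i w != 0.
Proof.
move=> Gg; apply: cpow_neq0; rewrite /denom.
rewrite eq_complex /= !(mulr0, mulr1, mul0r, oppr0, subr0, add0r, addr0).
apply/negP => /andP[/eqP d0 /eqP c0].
have [GS _ _ _] := subG; have /eqP := SL2R_det (GS _ Gg).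
by rewrite c0 d0 !mulr0 subrr eq_sym oner_eq0.
Qed.

Lemma jpow_Tmx x tau : jpow (Tmx x) tau w = 1.
Proof. by rewrite /jpow /denom !TmxE mul0r add0r cpow1. Qed.

(** A left translation keeps the lower row, so the automorphy factors of [g] and [Tmx x * g]
    cancel. *)
Lemma psi_Tmxl x g : G (Tmx x) -> G g -> psi (Tmx x * g) = psi (Tmx x) * psi g.
Proof.
move=> Gx Gg; have [_ psi_mul _] := psiM.
have := psi_mul _ _ 'i Gx Gg ltr01; rewrite jpow_Tmx mulr1.
rewrite (_ : jpow (Tmx x * g) _ _ = jpow g 'i w); last first.
  by rewrite /jpow /denom !mulmx2E !TmxE !mul0r !add0r !mul1r.
by move=> /(mulIf (jpow_i_neq0 Gg)).
Qed.

(** The denominator of [g] at tau + x is that of [g * Tmx x] at tau, so the automorphy factors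
    cancel again. *)
Lemma psi_Tmxr x g : G (Tmx x) -> G g -> psi (g * Tmx x) = psi g * psi (Tmx x).
Proof.
move=> Gx Gg; have [_ _ GM _] := subG; have [_ psi_mul _] := psiM.
have := psi_mul _ _ 'i Gg Gx ltr01; rewrite jpow_Tmx mulr1.
rewrite (_ : jpow g (mobius _ _) _ = jpow (g * Tmx x) 'i w); last first.
  rewrite /jpow /denom /mobius /denom !mulmx2E !TmxE.
  rewrite !(mul0r, mulr0, mulr1, add0r, addr0, mul1r) invr1 mulr1.
  by rewrite mulrDr rmorphD rmorphM addrA.
by move=> /(mulIf (jpow_i_neq0 (GM _ _ Gg Gx))).
Qed.

Lemma psi1 : psi 1 = 1.
Proof.
have [_ G1 _ _] := subG; have [psiN _ _] := psiM.
have GT : G (Tmx 0) by rewrite Tmx0.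
have := psi_Tmxl GT G1; rewrite Tmx0 mulr1 -[LHS]mul1r.
have p0 : psi 1 != 0 by rewrite -normr_eq0 psiN// oner_eq0.
by move=> /(mulIf p0).
Qed.


(** The matrices with the claimed property form a subgroup [Q] containing both generators [Tmx h]
    and [-1], so minimality applies. The sign is split off so that [psi] is evaluated on
    translations only, and [x] is chosen before [mu] so that it does not depend on it. *)
Lemma upper_triangular_Tmx h alpha p : G (-1) -> is_width G h ->
  psi (Tmx h) = ee alpha -> upper_triangular G p ->
  exists x, [/\ p = Tmx x \/ p = - Tmx x, G (Tmx x)
    & forall mu, shifted_lattice h alpha mu -> psi (Tmx x) = ee (- (mu * x))].
Proof.
move=> GN1 [h0 UE] psih; have [GS G1 GM GV] := subG.
pose Q := [set q | exists x, [/\ q = Tmx x \/ q = - Tmx x, G (Tmx x)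
  & forall mu, shifted_lattice h alpha mu -> psi (Tmx x) = ee (- (mu * x))]].
have Q0 : [/\ G (Tmx 0) & forall mu, shifted_lattice h alpha mu ->
    psi (Tmx 0) = ee (- (mu * 0))].
  by rewrite Tmx0; split=> // mu _; rewrite psi1 mulr0 oppr0 ee0.
suff : upper_triangular G `<=` Q by exact.
rewrite UE; apply: smallest_sub; last first.
  move=> q [->|->]; last first.
    by exists 0; have [? ?] := Q0; split=> //; right; rewrite Tmx0.
  exists h; split; first by left.
    have : upper_triangular G (Tmx h) by rewrite UE; apply: sub_gen_smallest; left.
    by case.
  (* Here mu h = m - alpha, hence e(-mu h) = e(alpha) e(-m) with e(-m) = 1. *)
  move=> _ [m _ <-]; rewrite psih divfK ?gt_eqF// opprB eeD -conj_ee ee_int conjc1.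
  by rewrite mulr1.
split.
- move=> _ [x [[->|->] Gx _]]; apply: GS => //.
  by rewrite -mulN1r; exact: GM.
- by exists 0; have [? ?] := Q0; split=> //; left; rewrite Tmx0.
- move=> q1 q2 [x [q1E Gx psix]] [y [q2E Gy psiy]]; exists (x + y).
  rewrite TmxD; split; last 2 first.
  + exact: GM.
  + by move=> mu muL; rewrite psi_Tmxl// (psix _ muL) (psiy _ muL) mulrDr opprD eeD.
  by case: q1E q2E => -> [] ->; rewrite ?(mulrN, mulNr, opprK); [left|right|right|left].
- move=> q [x [qE Gx psix]]; exists (- x); rewrite -Tmx_inv; split; last 2 first.
  + exact: GV.
  (* The value at [Tmx (- x)] is solved from psi(T^x) psi(T^(-x)) = psi(1) = 1. *)
  + move=> mu muL; have := psi_Tmxl Gx (GV _ Gx).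
    rewrite mulrV; last by apply: SL2R_unit; exact: GS.
    rewrite psi1 (psix _ muL).
    move=> /(congr1 ( *%R (ee (mu * x)))).
    by rewrite mulrA -eeD subrr ee0 mul1r mulr1 mulrN opprK => ->.
  by case: qE => ->; rewrite ?invrN; [left|right].
Qed.

(** The Bessel factor sees only the lower left entry, which translations preserve; in the
    Kloosterman factor a/c and d/c shift by x and y, and [psi] compensates. *)
Lemma double_coset_term h alpha mu nu g p :
  G (-1) -> is_width G h -> psi (Tmx h) = ee alpha ->
  shifted_lattice h alpha mu -> shifted_lattice h alpha nu ->
  G g -> 0 < g 1 0 -> 0 < p 1 0 -> double_coset G g p ->
  kloosterman_term psi mu nu g * bessel_term w mu nu g =
  kloosterman_term psi mu nu p * bessel_term w mu nu p.
Proof.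
move=> GN1 Gh psih muL nuL Gg g0 p0 [t Ut [u Uu] pE].
have [x [tE Gx psix]] := upper_triangular_Tmx GN1 Gh psih Ut.
have [y [uE Gy psiy]] := upper_triangular_Tmx GN1 Gh psih Uu.
have c_eq : (Tmx x * g * Tmx y) 1 0 = g 1 0.
  by rewrite !mulmx2E !TmxE; ring.
have {tE uE pE} pE : p = Tmx x * g * Tmx y.
  (* The signs of the two triangular factors combine into one, and positivity of both lower left
     entries excludes the minus sign. *)
  have [//|pN] : p = Tmx x * g * Tmx y \/ p = - (Tmx x * g * Tmx y).
    by rewrite -pE; case: tE uE => -> [] ->; rewrite ?(mulrN, mulNr, opprK);
      [left|right|right|left].
  by move: p0; rewrite pN mxN c_eq oppr_gt0 ltNge ltW.
have GM := let: And4 _ _ GM _ := subG in GM.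
have -> : bessel_term w mu nu p = bessel_term w mu nu g.
  by rewrite /bessel_term pE c_eq.
congr (_ * _); rewrite /kloosterman_term pE c_eq psi_Tmxr ?psi_Tmxl//; last exact: GM.
rewrite (psix _ muL) (psiy _ nuL).
have -> : (Tmx x * g * Tmx y) 0 0 / g 1 0 = g 0 0 / g 1 0 + x.
  by rewrite !mulmx2E !TmxE; field; rewrite gt_eqF.
have -> : (Tmx x * g * Tmx y) 1 1 / g 1 0 = g 1 1 / g 1 0 + y.
  by rewrite !mulmx2E !TmxE; field; rewrite gt_eqF.
rewrite !mulrDr !eeD.
have eeN z : ee z * ee (- z) = 1 :> R[i] by rewrite -eeD subrr ee0.
transitivity (ee (mu * (g 0 0 / g 1 0)) * ee (nu * (g 1 1 / g 1 0)) * psi g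
  * (ee (mu * x) * ee (- (mu * x))) * (ee (nu * y) * ee (- (nu * y)))).
  by rewrite !eeN !mulr1.
by ring.
Qed.

End Invariance.

(** * From single terms to the limits of the truncated sums *)

(** Eventual equality makes the two image filters equal, so the limits agree even as default
    values. *)
Lemma near_eq_lim (T : Type) (F : set_system T) (FF : Filter F)
    (U : pnbhsType) (f g : T -> U) : {near F, f =1 g} ->
  lim (f x @[x --> F]) = lim (g x @[x --> F]).
Proof.
move=> fg; congr (lim _); apply/seteqP; split; apply: near_eq_cvg => //.
by apply: filterS fg => x ->.
Qed.

Lemma conjc_mulrN (R : realType) (z1 z2 : R[i]) :
  (z1 * - z2)^*%C = - (z1 * z2)^*%C.
Proof. by rewrite mulrN; exact: (raddfN conjc). Qed.

Lemma kloosterman_term_conj (R : realType) (psi : 'M[R]_2 -> R[i]) mu nu g :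
  (kloosterman_term (conj_mult psi) (- mu) (- nu) g)^*%C =
  kloosterman_term psi mu nu g.
Proof.
by rewrite /kloosterman_term !conjcM !conj_ee !mulNr !opprK conjcK.
Qed.

(** The minus sign is attached to the power of [mu], so that the whole dual sum is scaled by a
    single nonzero constant. *)
Lemma rademacher_term_dual (R : realType) (psi : 'M[R]_2 -> R[i]) w mu nu g :
  1 <= w -> (1 < w -> mu != 0 /\ nu != 0) ->
  (kloosterman_term (conj_mult psi) (- mu) (- nu) g
    * bessel_term (2 - w) (- mu) (- nu) g * - cpow mu%:C (1 - w))^*%C
  = kloosterman_term psi mu nu g * bessel_term w mu nu g * cpow nu%:C (1 - w).
Proof.
move=> w1 munu; rewrite -[RHS]mulrA -bessel_term_dual//.
rewrite -(mulrA (kloosterman_term _ _ _ _)) conjcM kloosterman_term_conj.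
apply: (congr1 ( *%R _)).
exact: conjc_mulrN.
Qed.

Theorem mainTheorem2 (R : realType) (G : set 'M[R]_2) (w : R)
    (psi : 'M[R]_2 -> R[i]) (h alpha mu nu : R)
    (reps reps' : R -> set 'M[R]_2) :
  is_subgroup G -> G (-1) -> commensurable G SL2Z ->
  1 <= w ->
  is_multiplier G w psi -> standing_assumption G psi ->
  is_width G h ->
  0 <= alpha < 1 -> psi (Tmx h) = ee alpha ->
  shifted_lattice h alpha mu -> shifted_lattice h alpha nu ->
  (1 < w -> mu != 0 /\ nu != 0) ->
  (forall K : R, 0 < K -> double_coset_reps G K (reps K)) ->
  (forall K : R, 0 < K -> double_coset_reps G K (reps' K)) ->
  cvg (rademacher_sum reps psi w mu nu K @[K --> +oo]) ->
  cvg (rademacher_sum reps' (conj_mult psi) (2 - w) (- mu) (- nu) K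
         @[K --> +oo]) ->
  - (rademacher reps' h (conj_mult psi) (2 - w) (- mu) (- nu)
       * cpow mu%:C (1 - w))^*%C
  = rademacher reps h psi w mu nu * cpow nu%:C (1 - w).
Proof.
move=> subG GN1 _ w1 psiM _ Gh _ psih muL nuL munu repsP repsP' _ _.
have mu0 : - cpow mu%:C (1 - w) != 0.
  by rewrite oppr_eq0 cpow_weight_neq0// => /munu[].
have nu0 : cpow nu%:C (1 - w) != 0 by rewrite cpow_weight_neq0// => /munu[].
(* The duality already holds for each truncated sum, before any limit. *)
have sumE K : 0 < K ->
  (rademacher_sum reps' (conj_mult psi) (2 - w) (- mu) (- nu) K
     * - cpow mu%:C (1 - w))^*%C
  = rademacher_sum reps psi w mu nu K * cpow nu%:C (1 - w).
  move=> K0; rewrite /rademacher_sum [X in conjc X]mulr_fsuml.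
  rewrite [LHS](fsum_additive _ _ (can_inj (@conjcK R))).
  (* The original sum is moved to the representatives of the dual one, so that the terms can be
     matched matrix by matrix. *)
  rewrite (reindex_double_coset_reps (S' := reps' K)
    (f := fun g => kloosterman_term psi mu nu g * bessel_term w mu nu g)
    subG (repsP K K0) (repsP' K K0)).
    rewrite [RHS]mulr_fsuml; apply: eq_fsbigr => g _.
    exact: rademacher_term_dual.
  move=> g p /(repsP K K0).1[[Gg _] g0] /(repsP' K K0).1[_ p0].
  exact: (double_coset_term subG psiM GN1 Gh psih muL nuL).
rewrite /rademacher -conjc_mulrN.
rewrite -[RHS]mulrA -(mulrA (h^-1)%:C) conjcM conjc_real.
apply: (congr1 ( *%R _)).
pose S' K : R[i]^o :=
  rademacher_sum reps' (conj_mult psi) (2 - w) (- mu) (- nu) K.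
pose S K : R[i]^o := rademacher_sum reps psi w mu nu K.
transitivity (lim (((S' K * - cpow mu%:C (1 - w))^*%C : R[i]^o) @[K --> +oo])).
  by rewrite lim_conjc; apply: (congr1 conjc); exact: esym (lim_mulr S' mu0).
transitivity (lim ((S K * cpow nu%:C (1 - w) : R[i]^o) @[K --> +oo])); last first.
  exact: (lim_mulr S nu0).
(* The truncated identity requires [0 < K], which holds eventually. *)
apply: (@near_eq_lim _ +oo _ R[i]^o); near=> K; apply: sumE.
near: K; exact: nbhs_pinfty_gt.
Unshelve. all: by end_near. Qed.
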